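(* If $\Gamma;\Omega;\Delta\vdash M:A$, then there exists a term $N$ such that $(\Gamma,\Omega,\Delta)\vdash M\Uparrow N:A$ and $\Gamma;\Omega;\Delta\vdash N\Uparrow A$.
   Context: Strict $\lambda$-calculus over a fixed signature $\Sigma$ (atomic types $a$, constants $c{:}A$). Labels $k\in\{1,0,u\}$; types $A::=a\mid A_1\to^kA_2$; terms $c\mid x\mid\lambda x^k{:}A.M\mid M_1M_2^k$ (up to renaming of bound variables; $[N/x]M$ capture-avoiding substitution). Contexts: finite sets of declarations with distinct variables; commas denote disjoint union. Typing $\Gamma;\Omega;\Delta\vdash M:A$ ($\Gamma$ unrestricted, $\Omega$ irrelevant, $\Delta$ strict; disjoint): if $c{:}A\in\Sigma$ then $\Gamma;\Omega;\cdot\vdash c:A$; $(\Gamma,x{:}A);\Omega;\cdot\vdash x:A$; $\Gamma;\Omega;x{:}A\vdash x:A$ (no rule for $\Omega$); from $(\Gamma,x{:}A);\Omega;\Delta\vdash M:B$ infer $\Gamma;\Omega;\Delta\vdash\lambda x^u{:}A.M:A\to^uB$; from $\Gamma;(\Omega,x{:}A);\Delta\vdash M:B$ infer $\lambda x^0{:}A.M:A\to^0B$; from $\Gamma;\Omega;(\Delta,x{:}A)\vdash M:B$ infer $\lambda x^1{:}A.M:A\to^1B$; from $\Gamma;\Omega;\Delta\vdash M:A\to^uB$ and $(\Gamma,\Delta);\Omega;\cdot\vdash N:A$ infer $\Gamma;\Omega;\Delta\vdash MN^u:B$; from $\Gamma;\Omega;\Delta\vdash M:A\to^0B$ and $(\Gamma,\Omega,\Delta);\cdot;\cdot\vdash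 N:A$ infer $\Gamma;\Omega;\Delta\vdash MN^0:B$; from $(\Gamma,\Delta_N);\Omega;\Delta_M\vdash M:A\to^1B$ and $(\Gamma,\Delta_M);\Omega;\Delta_N\vdash N:A$ infer $\Gamma;\Omega;(\Delta_M,\Delta_N)\vdash MN^1:B$. Canonical/atomic forms $\Gamma;\Omega;\Delta\vdash M\Uparrow A$, $\Gamma;\Omega;\Delta\vdash M\downarrow A$ (mutually inductive): $c{:}A\in\Sigma$ gives $\Gamma;\Omega;\cdot\vdash c\downarrow A$; $(\Gamma,x{:}A);\Omega;\cdot\vdash x\downarrow A$; $\Gamma;\Omega;x{:}A\vdash x\downarrow A$; $M\downarrow a$ ($a$ atomic) gives $M\Uparrow a$ in the same contexts; the three $\lambda$ rules as for typing with $\Uparrow$ in premise and conclusion; the three application rules as for typing with the function premise and the conclusion in $\downarrow$ and the argument premise in $\Uparrow$. Conversion. Weak head reduction: $(\lambda x^k{:}A.M)N^k\to_{whr}[N/x]M$; if $M\to_{whr}Q$ then $MN^k\to_{whr}QN^k$. For a single context $\Psi$, $\Psi\vdash M\downarrow N:A$ and $\Psi\vdash M\Uparrow N:A$ are defined by: $c{:}A\in\Sigma$ gives $\Psi\vdash c\downarrow c:A$; $x{:}A\in\Psi$ gives $\Psi\vdash x\downarrow x:A$; if $M\to_{whr}M'$ and $\Psi\vdash M'\Uparrow M'':a$ then $\Psi\vdash M\Uparrow M'':a$; if $\Psi\vdash M\downarrow N:a$ then $\Psi\vdash M\Uparrow N:a$ ($a$ atomic); if $(\Psi,x{:}A)\vdash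 Mx^k\Uparrow N:B$ ($x$ fresh) then $\Psi\vdash M\Uparrow\lambda x^k{:}A.N:A\to^kB$; if $\Psi\vdash M\downarrow P:A\to^kB$ and $\Psi\vdash N\Uparrow Q:A$ then $\Psi\vdash MN^k\downarrow PQ^k:B$. $(\Gamma,\Omega,\Delta)$ denotes the union of the three contexts. *)

(* Defs.v *)
From mathcomp Require Import all_boot finmap.

Set Implicit Arguments.
Unset Strict Implicit.
Unset Printing Implicit Defensive.

Local Open Scope fset_scope.
Local Open Scope fmap_scope.

Inductive label : Set := Strict | Irrelevant | Unrestricted.

Inductive ty (atom : Type) : Type :=
| Atom of atom
| Arr of label & ty atom & ty atom.

(* Terms up to renaming of bound variables, in locally nameless style: free
   variables are names (natural numbers), bound ones are de Bruijn indices.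
   Every judgment below only relates locally closed terms (no dangling index)
   once its subject is locally closed, and typing forces local closure; see
   the lemmas at the end of the file. *)
Inductive tm (atom con : Type) : Type :=
| Cst of con
| Var of nat
| Idx of nat
| Lam of label & ty atom & tm atom con
| App of label & tm atom con & tm atom con.

Arguments Cst {atom con} _.
Arguments Var {atom con} _.
Arguments Idx {atom con} _.

Fixpoint fv (atom con : Type) (M : tm atom con) : {fset nat} :=
  match M with
  | Cst _ | Idx _ => fset0
  | Var x => [fset x]
  | Lam _ _ M1 => fv M1
  | App _ M1 M2 => fv M1 `|` fv M2
  end.

Fixpoint open_rec (atom con : Type) (n : nat) (N M : tm atom con) :
    tm atom con :=
  match M with
  | Cst _ | Var _ => M
  | Idx i => if i == n then N else M
  | Lam k A M1 => Lam k A (open_rec n.+1 N M1)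
  | App k M1 M2 => App k (open_rec n N M1) (open_rec n N M2)
  end.

(* If M is the body of a binder for x, [open N M] is the capture-avoiding
   substitution [N/x]M. *)
Definition open (atom con : Type) (N M : tm atom con) : tm atom con :=
  open_rec 0 N M.

Definition ctx (atom : Type) : Type := {fmap nat -> ty atom}.

Definition disjoint_ctxs (atom : Type) (s : seq (ctx atom)) : bool :=
  pairwise (fun C1 C2 : ctx atom => [disjoint domf C1 & domf C2]) s.

Definition fresh (atom : Type) (x : nat) (s : seq (ctx atom)) : bool :=
  all (fun C : ctx atom => x \notin domf C) s.

(* A signature gives each declared constant its type.  [typing Sg G O D M A]
   is G;O;D |- M : A with G unrestricted, O irrelevant and D strict.  In the
   rules for binders, [Lam k A M] is \x^k:A. M' with M' = open (Var x) M, for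
   some x not free in M.  The side conditions make every comma a disjoint union
   and the three contexts of every derivable judgment disjoint; in the rules
   without side conditions this already follows from the premises. *)
Inductive typing (atom con : Type) (Sg : con -> option (ty atom)) :
    ctx atom -> ctx atom -> ctx atom -> tm atom con -> ty atom -> Prop :=
| ty_cst (G O : ctx atom) c A :
    disjoint_ctxs [:: G; O] -> Sg c = Some A ->
    typing Sg G O [fmap] (Cst c) A
| ty_var_u (G O : ctx atom) x A :
    disjoint_ctxs [:: G; O] -> G.[? x] = Some A ->
    typing Sg G O [fmap] (Var x) A
| ty_var_1 (G O : ctx atom) x A :
    disjoint_ctxs [:: G; O] -> fresh x [:: G; O] ->
    typing Sg G O [fmap].[x <- A] (Var x) A
| ty_lam_u (G O D : ctx atom) x A M B :
    fresh x [:: G; O; D] -> x \notin fv M ->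
    typing Sg G.[x <- A] O D (open (Var x) M) B ->
    typing Sg G O D (Lam Unrestricted A M) (Arr Unrestricted A B)
| ty_lam_0 (G O D : ctx atom) x A M B :
    fresh x [:: G; O; D] -> x \notin fv M ->
    typing Sg G O.[x <- A] D (open (Var x) M) B ->
    typing Sg G O D (Lam Irrelevant A M) (Arr Irrelevant A B)
| ty_lam_1 (G O D : ctx atom) x A M B :
    fresh x [:: G; O; D] -> x \notin fv M ->
    typing Sg G O D.[x <- A] (open (Var x) M) B ->
    typing Sg G O D (Lam Strict A M) (Arr Strict A B)
| ty_app_u (G O D : ctx atom) M N A B :
    typing Sg G O D M (Arr Unrestricted A B) ->
    typing Sg (G + D) O [fmap] N A ->
    typing Sg G O D (App Unrestricted M N) B
| ty_app_0 (G O D : ctx atom) M N A B :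
    typing Sg G O D M (Arr Irrelevant A B) ->
    typing Sg (G + O + D) [fmap] [fmap] N A ->
    typing Sg G O D (App Irrelevant M N) B
| ty_app_1 (G O DM DN : ctx atom) M N A B :
    disjoint_ctxs [:: G; O; DM; DN] ->
    typing Sg (G + DN) O DM M (Arr Strict A B) ->
    typing Sg (G + DM) O DN N A ->
    typing Sg G O (DM + DN) (App Strict M N) B.

Inductive canonical (atom con : Type) (Sg : con -> option (ty atom)) :
    ctx atom -> ctx atom -> ctx atom -> tm atom con -> ty atom -> Prop :=
| can_atomic (G O D : ctx atom) M a :
    atomic Sg G O D M (Atom a) ->
    canonical Sg G O D M (Atom a)
| can_lam_u (G O D : ctx atom) x A M B :
    fresh x [:: G; O; D] -> x \notin fv M ->
    canonical Sg G.[x <- A] O D (open (Var x) M) B ->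
    canonical Sg G O D (Lam Unrestricted A M) (Arr Unrestricted A B)
| can_lam_0 (G O D : ctx atom) x A M B :
    fresh x [:: G; O; D] -> x \notin fv M ->
    canonical Sg G O.[x <- A] D (open (Var x) M) B ->
    canonical Sg G O D (Lam Irrelevant A M) (Arr Irrelevant A B)
| can_lam_1 (G O D : ctx atom) x A M B :
    fresh x [:: G; O; D] -> x \notin fv M ->
    canonical Sg G O D.[x <- A] (open (Var x) M) B ->
    canonical Sg G O D (Lam Strict A M) (Arr Strict A B)
with atomic (atom con : Type) (Sg : con -> option (ty atom)) :
    ctx atom -> ctx atom -> ctx atom -> tm atom con -> ty atom -> Prop :=
| at_cst (G O : ctx atom) c A :
    disjoint_ctxs [:: G; O] -> Sg c = Some A ->
    atomic Sg G O [fmap] (Cst c) A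
| at_var_u (G O : ctx atom) x A :
    disjoint_ctxs [:: G; O] -> G.[? x] = Some A ->
    atomic Sg G O [fmap] (Var x) A
| at_var_1 (G O : ctx atom) x A :
    disjoint_ctxs [:: G; O] -> fresh x [:: G; O] ->
    atomic Sg G O [fmap].[x <- A] (Var x) A
| at_app_u (G O D : ctx atom) M N A B :
    atomic Sg G O D M (Arr Unrestricted A B) ->
    canonical Sg (G + D) O [fmap] N A ->
    atomic Sg G O D (App Unrestricted M N) B
| at_app_0 (G O D : ctx atom) M N A B :
    atomic Sg G O D M (Arr Irrelevant A B) ->
    canonical Sg (G + O + D) [fmap] [fmap] N A ->
    atomic Sg G O D (App Irrelevant M N) B
| at_app_1 (G O DM DN : ctx atom) M N A B :
    disjoint_ctxs [:: G; O; DM; DN] ->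
    atomic Sg (G + DN) O DM M (Arr Strict A B) ->
    canonical Sg (G + DM) O DN N A ->
    atomic Sg G O (DM + DN) (App Strict M N) B.

Inductive whr (atom con : Type) : tm atom con -> tm atom con -> Prop :=
| whr_beta k A M N : whr (App k (Lam k A M) N) (open N M)
| whr_app k M Q N : whr M Q -> whr (App k M N) (App k Q N).

(* [conv_can Sg P M N A] is P |- M "double up arrow" N : A and
   [conv_at Sg P M N A] is P |- M "down arrow" N : A. *)
Inductive conv_can (atom con : Type) (Sg : con -> option (ty atom)) :
    ctx atom -> tm atom con -> tm atom con -> ty atom -> Prop :=
| cc_whr (P : ctx atom) M M' M'' a :
    whr M M' -> conv_can Sg P M' M'' (Atom a) ->
    conv_can Sg P M M'' (Atom a)
| cc_at (P : ctx atom) M N a :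
    conv_at Sg P M N (Atom a) ->
    conv_can Sg P M N (Atom a)
| cc_lam (P : ctx atom) x k A B M N :
    x \notin domf P -> x \notin fv M -> x \notin fv N ->
    conv_can Sg P.[x <- A] (App k M (Var x)) (open (Var x) N) B ->
    conv_can Sg P M (Lam k A N) (Arr k A B)
with conv_at (atom con : Type) (Sg : con -> option (ty atom)) :
    ctx atom -> tm atom con -> tm atom con -> ty atom -> Prop :=
| ca_cst (P : ctx atom) c A :
    Sg c = Some A -> conv_at Sg P (Cst c) (Cst c) A
| ca_var (P : ctx atom) x A :
    P.[? x] = Some A -> conv_at Sg P (Var x) (Var x) A
| ca_app (P : ctx atom) k M N Q R A B :
    conv_at Sg P M Q (Arr k A B) -> conv_can Sg P N R A ->
    conv_at Sg P (App k M N) (App k Q R) B.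

Scheme canonical_mut := Induction for canonical Sort Prop
with atomic_mut := Induction for atomic Sort Prop.
Combined Scheme canonical_atomic_ind from canonical_mut, atomic_mut.

Scheme conv_can_mut := Induction for conv_can Sort Prop
with conv_at_mut := Induction for conv_at Sort Prop.
Combined Scheme conv_can_at_ind from conv_can_mut, conv_at_mut.

Fixpoint lc_at (atom con : Type) (n : nat) (M : tm atom con) : bool :=
  match M with
  | Cst _ | Var _ => true
  | Idx i => i < n
  | Lam _ _ M1 => lc_at n.+1 M1
  | App _ M1 M2 => lc_at n M1 && lc_at n M2
  end.

Section Regularity.
Variables (atom con : Type) (Sg : con -> option (ty atom)).
Implicit Types (M N : tm atom con) (G O D P : ctx atom).

Lemma lc_at_open_var n x M :
  lc_at n (open_rec n (Var x) M) -> lc_at n.+1 M.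
Proof.
elim: M n => //= [i|k A M IH|k M1 IH1 M2 IH2] n.
- by case: eqP => [-> //|_ /= /ltnW].
- exact: IH.
- by case/andP=> /IH1 -> /IH2 ->.
Qed.

Lemma lc_at_le m n M : m <= n -> lc_at m M -> lc_at n M.
Proof.
elim: M m n => //= [i|k A M IH|k M1 IH1 M2 IH2] m n le_mn.
- by move/leq_trans; apply.
- exact: IH.
- by case/andP=> /(IH1 _ _ le_mn) -> /(IH2 _ _ le_mn) ->.
Qed.

Lemma lc_at_open_rec n N M :
  lc_at 0 N -> lc_at n.+1 M -> lc_at n (open_rec n N M).
Proof.
move=> lcN; elim: M n => //= [i|k A M IH|k M1 IH1 M2 IH2] n.
- case: eqP => [_ _|/eqP ne]; first exact: lc_at_le lcN.
  by rewrite ltnS leq_eqVlt (negPf ne).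
- exact: IH.
- by case/andP=> /IH1 -> /IH2 ->.
Qed.

Lemma typing_lc G O D M A : typing Sg G O D M A -> lc_at 0 M.
Proof.
by elim=> //= *; try (by apply/andP; split); apply: lc_at_open_var; eassumption.
Qed.

Lemma canonical_atomic_lc :
  (forall G O D M A, canonical Sg G O D M A -> lc_at 0 M) /\
  (forall G O D M A, atomic Sg G O D M A -> lc_at 0 M).
Proof.
apply: canonical_atomic_ind => //= *; try (by apply/andP; split);
  apply: lc_at_open_var; eassumption.
Qed.

Lemma whr_lc M N : whr M N -> lc_at 0 M -> lc_at 0 N.
Proof.
elim=> [k A M1 N1|k M1 Q N1 _ IH] /= /andP [lcM lcN].
- exact: lc_at_open_rec.
- by rewrite IH.
Qed.

Lemma conv_lc :
  (forall P M N A, conv_can Sg P M N A -> lc_at 0 M -> lc_at 0 N) /\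
  (forall P M N A, conv_at Sg P M N A -> lc_at 0 M -> lc_at 0 N).
Proof.
apply: conv_can_at_ind => //=.
- by move=> P M M' M'' a red _ IH lcM; apply/IH/(whr_lc red).
- move=> P x k A B M N _ _ _ _ IH lcM.
  by apply: (@lc_at_open_var _ x); apply: IH; rewrite lcM.
- by move=> P k M N Q R A B _ IH1 _ IH2 /andP [/IH1 -> /IH2 ->].
Qed.

Lemma typing_disjoint G O D M A :
  typing Sg G O D M A -> disjoint_ctxs [:: G; O; D].
Proof.
rewrite /disjoint_ctxs /fresh; elim=> //=.
- move=> G1 O1 c B dis _; rewrite !andbT in dis *.
  by rewrite dis !fdisjointX0.
- move=> G1 O1 c B dis _; rewrite !andbT in dis *.
  by rewrite dis !fdisjointX0.
- move=> G1 O1 x B; rewrite !andbT => dis /andP [xG xO].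
  by rewrite dis fsetU0 !fdisjointX1 xG xO.
- move=> G1 O1 D1 x B M1 C _ _ _; rewrite !andbT !fdisjointU1X.
  by case/andP=> /andP [/andP [_ ->] /andP [_ ->]] ->.
- move=> G1 O1 D1 x B M1 C _ _ _; rewrite !andbT.
  by rewrite fdisjointXU fdisjointUX -!andbA => /and5P [_ -> -> _ ->].
- move=> G1 O1 D1 x B M1 C _ _ _; rewrite !andbT.
  by rewrite !fdisjointXU -!andbA => /and5P [-> _ -> _ ->].
- move=> G1 O1 DM DN M1 N1 B C dis _ _ _ _; move: dis.
  rewrite !andbT !fdisjointXU => /and3P [/and3P [-> GM ->] /andP [OM ->] _].
  by rewrite !(fdisjointWr (fsubsetDl _ _)).
Qed.

End Regularity.

(* Main.v *)
Require Import Defs.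
From mathcomp Require Import all_boot finmap.

(* Strictness can be separated from normalization.  Call an occurrence of x in M
   strict if it lies only inside strict arguments, and relevant if it lies
   inside no irrelevant argument.  A judgment G;O;D |- M : A amounts to simple
   typing in the union of the contexts together with purely syntactic
   conditions: every variable of D has a strict occurrence in M, no variable of
   O has a relevant one, and the same holds at each 1- or 0-binder of M.  A
   Kripke logical relation over a single context gives N with M converting to N,
   ignoring these conditions.  Conversion never loses a strict occurrence and
   never creates a relevant one, so N satisfies the conditions too; and the
   conversion derivation itself shows that N is canonical. *)

Set Implicit Arguments.
Unset Strict Implicit.
Unset Printing Implicit Defensive.

Local Open Scope fset_scope.

(** * Simultaneous substitution and closing of locally nameless terms *)

Section Terms.
Variables (atom con : Type).
Implicit Types (M N : tm atom con) (s : nat -> tm atom con).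

(** Free names are replaced all at once and indices stay put, so nothing is captured when the values
    of [s] are locally closed. *)
Fixpoint subst s M : tm atom con :=
  match M with
  | Cst _ | Idx _ => M
  | Var x => s x
  | Lam k A M1 => Lam k A (subst s M1)
  | App k M1 M2 => App k (subst s M1) (subst s M2)
  end.

Definition upd (T : Type) (s : nat -> T) (x : nat) (t : T) (y : nat) : T :=
  if y == x then t else s y.

Lemma subst_Var M : subst Var M = M.
Proof. by elim: M => //= [k A M ->|k M -> N ->]. Qed.

Lemma eq_subst s s' M :
  (forall x, x \in fv M -> s x = s' x) -> subst s M = subst s' M.
Proof.
elim: M => //= [x|k A M IH|k M IHM N IHN] eq_s.
- by apply: eq_s; rewrite inE.
- by rewrite IH.
- by rewrite IHM ?IHN // => x xF; apply: eq_s; rewrite inE xF ?orbT.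
Qed.

Lemma subst_upd_fresh s x N M : x \notin fv M -> subst (upd s x N) M = subst s M.
Proof.
move=> xM; apply: eq_subst => y yM; rewrite /upd.
by case: eqP yM xM => // -> ->.
Qed.

Lemma open_rec_lc m n N M : lc_at m M -> m <= n -> open_rec n N M = M.
Proof.
elim: M m n => //= [i|k A M IH|k M IHM P IHP] m n.
- move=> lt_im le_mn; case: eqP => // eq_in; move: lt_im.
  by rewrite eq_in ltnNge le_mn.
- by move=> lcM le_mn; rewrite (IH m.+1).
- by case/andP=> lcM lcP le_mn; rewrite (IHM m) // (IHP m).
Qed.

Lemma subst_open_rec s n N M : (forall x, lc_at 0 (s x)) ->
  subst s (open_rec n N M) = open_rec n (subst s N) (subst s M).
Proof.
move=> lcs; elim: M n => //= [x|i|k A M IH|k M IHM P IHP] n.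
- by rewrite (open_rec_lc _ (lcs x)).
- by case: eqP.
- by rewrite IH.
- by rewrite IHM IHP.
Qed.

Lemma subst_lc s n M : (forall x, lc_at 0 (s x)) -> lc_at n M -> lc_at n (subst s M).
Proof.
move=> lcs; elim: M n => //= [x|k A M IH|k M IHM P IHP] n.
- by move=> _; apply: lc_at_le (lcs x).
- exact: IH.
- by case/andP=> /IHM -> /IHP ->.
Qed.

Lemma upd_lc s x N : (forall y, lc_at 0 (s y)) -> lc_at 0 N ->
  forall y, lc_at 0 (upd s x N y).
Proof. by move=> lcs lcN y; rewrite /upd; case: eqP. Qed.

Lemma subst_upd_open s x N M : (forall y, lc_at 0 (s y)) -> lc_at 0 N ->
  x \notin fv M -> subst (upd s x N) (open (Var x) M) = open N (subst s M).
Proof.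
move=> lcs lcN xM; rewrite /open subst_open_rec; last exact: upd_lc.
by rewrite (subst_upd_fresh _ _ xM) /= /upd eqxx.
Qed.

Lemma whr_subst s M N : (forall x, lc_at 0 (s x)) ->
  whr M N -> whr (subst s M) (subst s N).
Proof.
move=> lcs; elim=> [k A M1 N1|k M1 Q N1 _ IH] /=; last exact: whr_app.
by rewrite /open subst_open_rec //; apply: whr_beta.
Qed.

(** Inverse of opening: it turns a normal form mentioning a fresh name into the body of an
    abstraction. *)
Fixpoint close_rec n x M : tm atom con :=
  match M with
  | Cst _ | Idx _ => M
  | Var y => if y == x then Idx n else M
  | Lam k A M1 => Lam k A (close_rec n.+1 x M1)
  | App k M1 M2 => App k (close_rec n x M1) (close_rec n x M2)
  end.

Lemma open_close_rec n x M : lc_at n M -> open_rec n (Var x) (close_rec n x M) = M.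
Proof.
elim: M n => //= [y|i|k A M IH|k M IHM P IHP] n.
- by case: eqP => [-> /=|//]; rewrite eqxx.
- by case: eqP => // ->; rewrite ltnn.
- by move/IH ->.
- by case/andP=> /IHM -> /IHP ->.
Qed.

Lemma close_rec_fresh n x M : x \notin fv (close_rec n x M).
Proof.
elim: M n => //= [y|k M IHM P IHP] n.
- by case: eqP => //= /eqP; rewrite inE eq_sym.
- by rewrite inE negb_or IHM IHP.
Qed.

Lemma fresh_exists (s : {fset nat}) : exists x, x \notin s.
Proof.
exists (\max_(y <- s) y).+1; apply/negP => y_s.
by have :=
  leq_bigmax_seq (r := enum_fset s) (P := xpredT) (F := id) _ y_s isT; rewrite ltnn.
Qed.

End Terms.

(** * Existence of a normal form *)

Section Reducibility.
Local Open Scope fmap_scope.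
Variables (atom con : Type) (Sg : con -> option (ty atom)).
Implicit Types (M N : tm atom con) (G O D P : ctx atom) (A B : ty atom).

(** * Weakening of conversion *)

Definition extends P P' := forall x A, P.[? x] = Some A -> P'.[? x] = Some A.

Lemma extends_set P x A : x \notin domf P -> extends P P.[x <- A].
Proof.
move=> xP y B Py; rewrite fnd_set; case: eqP => // eq_yx.
by move: Py; rewrite eq_yx not_fnd.
Qed.

(* Renaming, rather than plain weakening, is what the induction supports: the
   name chosen by [cc_lam] may already be declared in the larger context. *)
Lemma conv_rename :
  (forall P M N A, conv_can Sg P M N A -> forall P' (r : nat -> nat),
     (forall x B, P.[? x] = Some B -> P'.[? r x] = Some B) ->
     conv_can Sg P' (subst (Var \o r) M) (subst (Var \o r) N) A) /\
  (forall P M N A, conv_at Sg P M N A -> forall P' (r : nat -> nat),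
     (forall x B, P.[? x] = Some B -> P'.[? r x] = Some B) ->
     conv_at Sg P' (subst (Var \o r) M) (subst (Var \o r) N) A).
Proof.
apply: conv_can_at_ind => /=.
- move=> P M M' M'' a red _ IH P' r Pr.
  by apply: cc_whr (IH _ _ Pr); apply: whr_subst.
- by move=> P M N a _ IH P' r Pr; apply/cc_at/IH.
- move=> P x k A B M N xP xM xN _ IH P' r Pr.
  have [y] := fresh_exists (domf P' `|` fv (subst (Var \o r) M)
                              `|` fv (subst (Var \o r) N)).
  rewrite !inE !negb_or => /andP [/andP [yP' yM] yN].
  apply: (cc_lam (x := y)) => //.
  have upd_r z : (Var \o upd r x y) z = upd (Var \o r) x (Var y) z :> tm atom con.
    by rewrite /upd /=; case: eqP.
  have {IH} := IH P'.[y <- A] (upd r x y).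
  rewrite !(eq_subst (s := Var \o upd r x y) (s' := upd (Var \o r) x (Var y))) //.
  rewrite subst_upd_open // subst_upd_fresh // /upd eqxx; apply=> z C.
  (* A declared name other than [x] keeps its image under [r], which lies in [P'] and so differs
     from [y]. *)
  rewrite !fnd_set; case: eqP => [_|_ /Pr Pz]; first by rewrite eqxx.
  by case: eqP => // eq_y; move: Pz; rewrite eq_y not_fnd.
- by move=> P c A Sc P' r _; apply: ca_cst.
- by move=> P x A Px P' r Pr; apply/ca_var/Pr.
- move=> P k M N Q R A B _ IHM _ IHN P' r Pr.
  by apply: ca_app (IHM _ _ Pr) (IHN _ _ Pr).
Qed.

Lemma conv_can_weaken P P' M N A :
  extends P P' -> conv_can Sg P M N A -> conv_can Sg P' M N A.
Proof.
move=> PP' cMN; have := conv_rename.1 _ _ _ _ cMN P' id PP'.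
by rewrite !subst_Var.
Qed.

Lemma conv_at_weaken P P' M N A :
  extends P P' -> conv_at Sg P M N A -> conv_at Sg P' M N A.
Proof.
move=> PP' cMN; have := conv_rename.2 _ _ _ _ cMN P' id PP'.
by rewrite !subst_Var.
Qed.

(** * The Kripke logical relation *)

(** Arrow types quantify over larger contexts so that a fresh variable can serve as argument;
    arguments are locally closed because they enter substitutions. *)
Fixpoint red P A M : Prop :=
  match A with
  | Atom a => exists N, conv_can Sg P M N (Atom a)
  | Arr k A B => forall P' N,
      extends P P' -> lc_at 0 N -> red P' A N -> red P' B (App k M N)
  end.

Lemma red_weaken P P' A M : extends P P' -> red P A M -> red P' A M.
Proof.
case: A => [a|k A B] /= PP'.
- by case=> N cMN; exists N; apply: conv_can_weaken cMN.
- by move=> redM P'' N P'P''; apply: redM => x C /PP' /P'P''.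
Qed.

(** Head reduction passes under application, so expansion at an arrow type comes down to [cc_whr] at
    an atomic one. *)
Lemma red_whr P A M M' : whr M M' -> red P A M' -> red P A M.
Proof.
elim: A P M M' => [a|k A _ B IH] P M M' MM' /=.
- by case=> N cMN; exists N; apply: cc_whr cMN.
- move=> redM' P' N PP' lcN redN; apply: (IH _ _ (App k M' N)).
    exact: whr_app.
  exact: redM'.
Qed.

Lemma conv_lc_normal :
  (forall P M N A, conv_can Sg P M N A -> lc_at 0 N) /\
  (forall P M N A, conv_at Sg P M N A -> lc_at 0 N).
Proof.
apply: conv_can_at_ind => //= [*|P k M N Q R A B _ -> _ ->//].
by apply: lc_at_open_var; eassumption.
Qed.

(** Reification and reflection need a joint induction on the type: at an arrow, reification reflects
    a fresh variable in the domain, and reflection reifies the argument. *)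
Lemma red_conv A :
  (forall P M, red P A M -> exists N, conv_can Sg P M N A) /\
  (forall P M N, conv_at Sg P M N A -> red P A M).
Proof.
elim: A => [a|k A [reifyA reflectA] B [reifyB reflectB]] /=; split=> //.
- by move=> P M N cMN; exists N; apply: cc_at.
- move=> P M redM; have [x] := fresh_exists (domf P `|` fv M).
  rewrite !inE negb_or => /andP [xP xM].
  have redx : red P.[x <- A] A (Var x).
    by apply: (reflectA _ _ (Var x)); apply: ca_var; rewrite fnd_set eqxx.
  (* Abstracting [x] from a normal form of [App k M (Var x)] gives the eta-long form of [M]. *)
  have [N cN] := reifyB _ _ (redM _ (Var x) (extends_set A xP) isT redx).
  exists (Lam k A (close_rec 0 x N)); apply: (cc_lam (x := x)) => //.
    exact: close_rec_fresh.
  by rewrite /open open_close_rec //; apply: conv_lc_normal.1 cN.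
- move=> P M N cMN P' Q PP' _ /reifyA [R cQR].
  apply: (reflectB _ _ (App k N R)); apply: ca_app cQR.
  exact: conv_at_weaken cMN.
Qed.

(** * The fundamental lemma *)

Definition declared G O D x A :=
  [\/ G.[? x] = Some A, O.[? x] = Some A | D.[? x] = Some A].

Definition red_subst P G O D (s : nat -> tm atom con) :=
  (forall x, lc_at 0 (s x)) /\ (forall x A, declared G O D x A -> red P A (s x)).

Lemma fnd_cat_or G D x A :
  (G + D).[? x] = Some A ->
  G.[? x] = Some A \/ D.[? x] = Some A.
Proof. by rewrite fnd_cat; case: ifP; auto. Qed.

(** Serves all three abstraction rules: the hypothesis on declarations hides which zone receives
    [x]. The beta redex expands the body evaluated with [x] sent to the argument. *)
Lemma red_lam k P G O D G' O' D' s x A B M :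
  red_subst P G O D s -> x \notin fv M ->
  (forall y C, declared G' O' D' y C -> y = x /\ C = A \/ y <> x /\ declared G O D y C) ->
  (forall P' s', red_subst P' G' O' D' s' -> red P' B (subst s' (open (Var x) M))) ->
  red P (Arr k A B) (Lam k A (subst s M)).
Proof.
move=> [lcs reds] xM decl IH P' N PP' lcN redN /=.
apply: red_whr (whr_beta _ _ _ _) _; rewrite -(subst_upd_open (x := x)) //.
apply: IH; split=> [|y C /decl]; first exact: upd_lc.
rewrite /upd; case: eqP => [_|_] [[//]|[//]]; first by move=> _ ->.
by move=> _ /reds; apply: red_weaken.
Qed.

Lemma fnd_set_or G x A y C : G.[x <- A].[? y] = Some C ->
  y = x /\ C = A \/ y <> x /\ G.[? y] = Some C.
Proof. by rewrite fnd_set; case: eqP => [-> [->]|]; auto. Qed.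

Lemma typing_red G O D M A : typing Sg G O D M A ->
  forall P s, red_subst P G O D s -> red P A (subst s M).
Proof.
elim=> {G O D M A} /=.
- move=> G O c A _ Sc P s _.
  by apply: (red_conv A).2; apply: ca_cst.
- by move=> G O x A _ Gx P s [_ reds]; apply: reds; apply: Or31.
- move=> G O x A _ _ P s [_ reds]; apply: reds; apply: Or33.
  by rewrite fnd_set eqxx.
- move=> G O D x A M B /and4P [xG xO xD _] xM _ IH P s reds.
  apply: red_lam reds xM _ IH => y C [] decl.
  + by case/fnd_set_or: decl => [|[]]; [left|right; split=> //; apply: Or31].
  + by right; split; [move=> eq_y; rewrite eq_y not_fnd in decl|apply: Or32].
  + by right; split; [move=> eq_y; rewrite eq_y not_fnd in decl|apply: Or33].
- move=> G O D x A M B /and4P [xG xO xD _] xM _ IH P s reds.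
  apply: red_lam reds xM _ IH => y C [] decl.
  + by right; split; [move=> eq_y; rewrite eq_y not_fnd in decl|apply: Or31].
  + by case/fnd_set_or: decl => [|[]]; [left|right; split=> //; apply: Or32].
  + by right; split; [move=> eq_y; rewrite eq_y not_fnd in decl|apply: Or33].
- move=> G O D x A M B /and4P [xG xO xD _] xM _ IH P s reds.
  apply: red_lam reds xM _ IH => y C [] decl.
  + by right; split; [move=> eq_y; rewrite eq_y not_fnd in decl|apply: Or31].
  + by right; split; [move=> eq_y; rewrite eq_y not_fnd in decl|apply: Or32].
  + by case/fnd_set_or: decl => [|[]]; [left|right; split=> //; apply: Or33].
- move=> G O D M N A B _ IHM tN IHN P s reds.
  apply: (IHM _ _ reds P) => //; first exact: subst_lc reds.1 (typing_lc tN).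
  apply: IHN; split=> [|x C decl]; first exact: reds.1.
  apply: reds.2; case: decl; rewrite ?fnd_fmap0 //; last exact: Or32.
  by case/fnd_cat_or; [apply: Or31|apply: Or33].
- move=> G O D M N A B _ IHM tN IHN P s reds.
  apply: (IHM _ _ reds P) => //; first exact: subst_lc reds.1 (typing_lc tN).
  apply: IHN; split=> [|x C decl]; first exact: reds.1.
  apply: reds.2; case: decl; rewrite ?fnd_fmap0 //.
  by case/fnd_cat_or; [case/fnd_cat_or; [apply: Or31|apply: Or32]|apply: Or33].
- move=> G O DM DN M N A B dis _ IHM tN IHN P s [lcs reds].
  (* Union of finite maps is right-biased; disjointness makes it commute, so both parts embed in
     it. *)
  have DMDN : DM + DN = DN + DM.
    apply: disjoint_catfC; move: dis; rewrite /disjoint_ctxs /=.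
    by rewrite !andbT => /andP [_ /andP [_]].
  have inl x C : DM.[? x] = Some C -> (DM + DN).[? x] = Some C.
    by rewrite DMDN fnd_cat => Dx; rewrite -fndSome Dx.
  have inr x C : DN.[? x] = Some C -> (DM + DN).[? x] = Some C.
    by rewrite fnd_cat => Dx; rewrite -fndSome Dx.
  have redsM : red_subst P (G + DN) O DM s.
    split=> // x C [/fnd_cat_or [Gx|/inr Dx]|Ox|/inl Dx]; apply: reds;
    by [apply: Or31|apply: Or32|apply: Or33].
  have redsN : red_subst P (G + DM) O DN s.
    split=> // x C [/fnd_cat_or [Gx|/inl Dx]|Ox|/inr Dx]; apply: reds;
    by [apply: Or31|apply: Or32|apply: Or33].
  apply: (IHM _ _ redsM P) => //; first exact: subst_lc lcs (typing_lc tN).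
  exact: IHN.
Qed.

(** By reflection the identity substitution is reducible, so the fundamental lemma makes [M]
    reducible, and reification gives [N]. *)
Lemma typing_normalizes G O D M A :
  typing Sg G O D M A -> exists N, conv_can Sg (G + O + D) M N A.
Proof.
move=> tM; have := typing_disjoint tM.
rewrite /disjoint_ctxs /= !andbT => /andP [/andP [GO GD] OD].
apply: (red_conv A).1; rewrite -[M]subst_Var; apply: (typing_red tM).
split=> // x B decl; apply: (red_conv B).2; apply: ca_var.
have out (C C' : ctx atom) : [disjoint domf C & domf C'] -> x \in domf C' ->
    C.[? x] = None.
  by move=> dis xC'; rewrite not_fnd // (fdisjointP_sym dis).
rewrite !fnd_cat; case: ifP => xD; last case: ifP => xO.
- by case: decl => //; rewrite (out _ D).
- by case: decl => //; [rewrite (out _ O)|rewrite not_fnd ?xD].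
- by case: decl => //; rewrite not_fnd ?xD ?xO.
Qed.

End Reducibility.

(** * Strict and relevant occurrences *)

Section Occurrences.
Variables (atom con : Type) (Sg : con -> option (ty atom)).
Implicit Types (M N : tm atom con) (f : pred label).

(* [f] selects the application labels whose arguments are searched. *)
Fixpoint occ f (x : nat) M : bool :=
  match M with
  | Cst _ | Idx _ => false
  | Var y => y == x
  | Lam _ _ M1 => occ f x M1
  | App k M1 M2 => occ f x M1 || f k && occ f x M2
  end.

Fixpoint occ_idx f (n : nat) M : bool :=
  match M with
  | Cst _ | Var _ => false
  | Idx i => i == n
  | Lam _ _ M1 => occ_idx f n.+1 M1
  | App k M1 M2 => occ_idx f n M1 || f k && occ_idx f n M2
  end.

Definition strict_arg : pred label := fun k => if k is Strict then true else false.
Definition relevant_arg : pred label :=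
  fun k => if k is Irrelevant then false else true.

(** Stated on the dangling index 0 of the body, so that [moded] recurses structurally without
    choosing names. *)
Definition well_labelled (k : label) M : bool :=
  match k with
  | Strict => occ_idx strict_arg 0 M
  | Irrelevant => ~~ occ_idx relevant_arg 0 M
  | Unrestricted => true
  end.

Fixpoint moded M : bool :=
  match M with
  | Cst _ | Var _ | Idx _ => true
  | Lam k _ M1 => well_labelled k M1 && moded M1
  | App _ M1 M2 => moded M1 && moded M2
  end.

Lemma occ_fresh f x M : x \notin fv M -> occ f x M = false.
Proof.
elim: M => //= [y|k M IHM N IHN].
- by rewrite inE eq_sym => /negPf.
- by rewrite inE negb_or => /andP [/IHM -> /IHN ->]; rewrite andbF.
Qed.

Lemma occ_idx_lc f m n M : lc_at m M -> m <= n -> occ_idx f n M = false.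
Proof.
elim: M m n => //= [i|k A M IH|k M IHM N IHN] m n.
- by move=> lt_im le_mn; apply/eqP => eq_in; rewrite eq_in ltnNge le_mn in lt_im.
- by move=> lcM le_mn; apply: IH lcM _.
- by case/andP=> lcM lcN le_mn; rewrite (IHM m) // (IHN m) // andbF.
Qed.

(** The condition on an occurrence concerns only the arguments enclosing it, so it composes: a new
    occurrence is one in [N] placed at one of the index. *)
Lemma occ_open_rec f x n N M :
  occ f x (open_rec n N M) = occ f x M || occ_idx f n M && occ f x N.
Proof.
elim: M n => //= [y|i|k M IHM P IHP] n.
- by rewrite orbF.
- by case: eqP.
- rewrite IHM IHP; case: (f k) => /=; case: (occ f x M) => //=;
  by case: (occ_idx f n M) => //=; case: (occ f x N);
     rewrite ?(andbF, andbT, orbT, orbF).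
Qed.

Lemma occ_idx_open_rec f m n N M : lc_at 0 N -> m != n ->
  occ_idx f m (open_rec n N M) = occ_idx f m M.
Proof.
move=> lcN; elim: M m n => //= [i|k A M IH|k M IHM P IHP] m n ne_mn.
- case: eqP => //= ->; rewrite (occ_idx_lc _ lcN) //.
  by rewrite eq_sym (negPf ne_mn).
- exact: IH.
- by rewrite IHM // IHP.
Qed.

Lemma well_labelled_open_rec k n N M : lc_at 0 N ->
  well_labelled k (open_rec n.+1 N M) = well_labelled k M.
Proof. by move=> lcN; case: k => //=; rewrite occ_idx_open_rec. Qed.

Lemma moded_open_rec n N M :
  lc_at 0 N -> moded M -> moded N -> moded (open_rec n N M).
Proof.
move=> lcN mM mN; elim: M n mM => //= [i|k A M IH|k M IHM P IHP] n.
- by case: eqP.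
- by rewrite well_labelled_open_rec // => /andP [-> /IH ->].
- by case/andP=> /IHM -> /IHP ->.
Qed.

Lemma moded_open_rec_var n x M : moded (open_rec n (Var x) M) = moded M.
Proof.
elim: M n => //= [i|k A M IH|k M IHM P IHP] n.
- by case: eqP.
- by rewrite well_labelled_open_rec // IH.
- by rewrite IHM IHP.
Qed.

Lemma occ_open_var f x M : x \notin fv M -> occ f x (open (Var x) M) = occ_idx f 0 M.
Proof. by move=> xM; rewrite occ_open_rec occ_fresh //= eqxx andbT. Qed.

Lemma occ_open_var_neq f x y M : y != x -> occ f y (open (Var x) M) = occ f y M.
Proof. by move=> ne_yx; rewrite occ_open_rec /= eq_sym (negPf ne_yx) andbF orbF. Qed.

(** * Effect of conversion on occurrences *)

Definition refines M N :=
  [/\ moded N, forall x, occ strict_arg x M -> occ strict_arg x N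
    & forall x, occ relevant_arg x N -> occ relevant_arg x M].

(** In a beta step with label 1 the bound variable has a strict occurrence, so strict occurrences in
    the argument survive in that copy. A relevant occurrence coming from the argument requires a
    relevant occurrence of the bound variable, which excludes label 0; hence it was relevant in the
    redex. *)
Lemma whr_refines M N : whr M N -> lc_at 0 M -> moded M -> refines M N.
Proof.
elim=> [k A M1 N1|k M1 Q N1 _ IH] /= /andP [lcM lcN].
- case/andP=> /andP [wlM mM] mN; split=> [|x|x]; first exact: moded_open_rec.
  + rewrite occ_open_rec /= => /orP [->//|/andP [sk ->]].
    by case: k sk wlM => //= _ ->; rewrite orbT.
  + rewrite occ_open_rec /= => /orP [->//|/andP [rM ->]].
    by case: k wlM; rewrite /= ?rM ?orbT.
- case/andP=> mM mN; have [mQ sQ rQ] := IH lcM mM; split=> [|x|x].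
  + by rewrite /= mQ.
  + by rewrite /=; case/orP=> [/sQ ->//|->]; rewrite orbT.
  + by rewrite /=; case/orP=> [/rQ ->//|->]; rewrite orbT.
Qed.

Lemma conv_refines :
  (forall P M N A, conv_can Sg P M N A -> lc_at 0 M -> moded M -> refines M N) /\
  (forall P M N A, conv_at Sg P M N A -> lc_at 0 M -> moded M -> refines M N).
Proof.
apply: conv_can_at_ind => //=.
- move=> P M M' M'' a red _ IH lcM mM.
  have [mM' sM' rM'] := whr_refines red lcM mM.
  have [mM'' sM'' rM''] := IH (whr_lc red lcM) mM'.
  by split=> // x; [move/sM'/sM''|move/rM''/rM'].
- move=> P x k A B M N _ xM xN _ IH lcM mM.
  have [|//=|mN sN rN] := IH; rewrite ?lcM ?mM //.
  have ne_x f y : occ f y M -> y != x.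
    by apply: contraTneq => ->; rewrite occ_fresh.
  split=> [|y sy|y ry] /=.
  + rewrite -(moded_open_rec_var 0 x) mN andbT.
    (* The fresh [x] is strict in [App k M (Var x)] for label 1 and not relevant there for label 0;
       the body inherits both facts. *)
    case: k sN rN {IH} => //= [sN _|_ /(_ x)].
      by rewrite -(occ_open_var _ xN); apply: sN; rewrite eqxx orbT.
    by rewrite occ_open_var // occ_fresh //=; case: occ_idx => // /(_ isT).
  + by rewrite -(occ_open_var_neq _ _ (ne_x _ _ sy)); apply: sN; rewrite /= sy.
  + have ne_yx : y != x by apply: contraTneq ry => ->; rewrite /= occ_fresh.
    move: ry; rewrite /= -(occ_open_var_neq _ _ ne_yx) => /rN /=.
    by rewrite (eq_sym x) (negPf ne_yx) andbF orbF.
- move=> P k M N Q R A B _ IHM _ IHN /andP [lcM lcN] /andP [mM mN].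
  have [mQ sQ rQ] := IHM lcM mM; have [mR sR rR] := IHN lcN mN.
  split=> [|x|x] /=; first by rewrite mQ.
  + by case/orP=> [/sQ ->//|/andP [-> /sR ->]]; rewrite orbT.
  + by case/orP=> [/rQ ->//|/andP [-> /rR ->]]; rewrite orbT.
Qed.

(** * Occurrence conditions implied by typing *)

Implicit Types (G O D P : ctx atom) (A B : ty atom).
Local Open Scope fmap_scope.

Definition respects O D M :=
  [/\ moded M, {in domf D, forall x, occ strict_arg x M}
    & {in domf O, forall x, ~~ occ relevant_arg x M}].

Lemma typing_respects G O D M A : typing Sg G O D M A -> respects O D M.
Proof.
elim=> {G O D M A}.
- by move=> G O c A _ _; split=> // x; rewrite domf0.
- move=> G O x A dis Gx; split=> [//|y|y yO] //=.
  apply: contraTneq yO => <-; apply: (fdisjointP (A := domf G)).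
    by move: dis; rewrite /disjoint_ctxs /= !andbT.
  by rewrite -fndSome Gx.
- move=> G O x A _ /and3P [xG xO _]; split=> [//|y|y yO] /=.
    by rewrite !inE orbF eq_sym.
  by apply: contraTneq yO => <-.
- move=> G O D x A M B /and4P [xG xO xD _] xM _ [mM sM rM].
  split=> [|y yD|y yO] /=; first by rewrite -(moded_open_rec_var 0 x).
  + rewrite -(@occ_open_var_neq _ x) ?sM //.
    by apply: contraTneq yD => ->.
  + rewrite -(@occ_open_var_neq _ x) ?rM //.
    by apply: contraTneq yO => ->.
- move=> G O D x A M B /and4P [xG xO xD _] xM _ [mM sM rM].
  split=> [|y yD|y yO] /=.
  + rewrite -(moded_open_rec_var 0 x) mM andbT -(occ_open_var _ xM).
    by apply: rM; rewrite !inE eqxx.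
  + rewrite -(@occ_open_var_neq _ x) ?sM //.
    by apply: contraTneq yD => ->.
  + rewrite -(@occ_open_var_neq _ x) ?rM // ?inE ?yO ?orbT //.
    by apply: contraTneq yO => ->.
- move=> G O D x A M B /and4P [xG xO xD _] xM _ [mM sM rM].
  split=> [|y yD|y yO] /=.
  + rewrite -(moded_open_rec_var 0 x) mM andbT -(occ_open_var _ xM).
    by apply: sM; rewrite !inE eqxx.
  + rewrite -(@occ_open_var_neq _ x) ?sM // ?inE ?yD ?orbT //.
    by apply: contraTneq yD => ->.
  + rewrite -(@occ_open_var_neq _ x) ?rM //.
    by apply: contraTneq yO => ->.
- move=> G O D M N A B _ [mM sM rM] _ [mN _ rN].
  split=> [|y yD|y yO] /=; first by rewrite mM.
  + by rewrite sM.
  + by rewrite negb_or rM ?rN.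
(* Neither search enters an irrelevant argument, so only modedness of [N] matters. *)
- move=> G O D M N A B _ [mM sM rM] _ [mN _ _].
  split=> [|y yD|y yO] /=; first by rewrite mM.
  + by rewrite sM.
  + by rewrite orbF rM.
- move=> G O DM DN M N A B _ _ [mM sM rM] _ [mN sN rN].
  split=> [|y|y yO]; first by rewrite /= mM.
  + by rewrite domf_cat inE /= => /orP [/sM ->|/sN ->]; rewrite ?orbT.
  + by rewrite /= negb_or rM ?rN.
Qed.

(** * From conversion derivations to canonical forms *)

Lemma disjoint3E (G O D : ctx atom) : disjoint_ctxs [:: G; O; D] =
  [&& [disjoint domf G & domf O]%fset, [disjoint domf G & domf D]%fset
    & [disjoint domf O & domf D]%fset].
Proof. by rewrite /disjoint_ctxs /= !andbT andbA. Qed.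

Lemma domf_sub_nil D : {in domf D, forall x, false} -> D = [fmap].
Proof.
by move=> D0; apply/fmap_nil/fsetP => x; rewrite inE; apply/negP => /D0.
Qed.

Local Arguments disjoint_ctxs : simpl never.

(** A conversion derivation already has the shape of a canonical one for its output; the zones are
    restored from [respects]. *)
Lemma conv_canonical :
  (forall P M N A, conv_can Sg P M N A -> forall G O D, P = G + O + D ->
     disjoint_ctxs [:: G; O; D] -> respects O D N -> canonical Sg G O D N A) /\
  (forall P M N A, conv_at Sg P M N A -> forall G O D, P = G + O + D ->
     disjoint_ctxs [:: G; O; D] -> respects O D N -> atomic Sg G O D N A).
Proof.
apply: conv_can_at_ind => //.
- by move=> P M N a _ IH G O D defP dis rN; apply: can_atomic; apply: IH.
- move=> P x k A B M N xP xM xN _ IH G O D defP dis [/= /andP [wlN mN] sN rN].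
  move: xP; rewrite defP !domf_cat !inE !negb_or => /andP [/andP [xG xO] xD].
  have ne (C : ctx atom) y : x \notin domf C -> y \in domf C -> y != x.
    by move=> xC; apply: contraTneq => ->.
  have sx y : y \in domf D -> occ strict_arg y (open (Var x) N).
    by move=> yD; rewrite occ_open_var_neq ?sN ?(ne D).
  have rx y : y \in domf O -> ~~ occ relevant_arg y (open (Var x) N).
    by move=> yO; rewrite occ_open_var_neq ?rN ?(ne O).
  have mx : moded (open (Var x) N) by rewrite /open moded_open_rec_var.
  move: dis; rewrite disjoint3E => /and3P [GO GD OD].
  (* The label selects the zone receiving [x], and [wlN] is the condition which that zone
     imposes. *)
  case: k wlN IH => /= wlN IH.
  + apply: (can_lam_1 (x := x)) => //; first by rewrite /fresh /= xG xO xD.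
    apply: IH; first by rewrite defP catf_setr.
      by rewrite disjoint3E /= !fdisjointXU !fdisjointX1 xG xO GO GD OD.
    split=> // y; rewrite !inE => /orP [/eqP ->|/sx //].
    by rewrite occ_open_var.
  + apply: (can_lam_0 (x := x)) => //; first by rewrite /fresh /= xG xO xD.
    apply: IH; first by rewrite defP catf_setr catf_setl ifN.
      by rewrite disjoint3E /= fdisjointXU fdisjointUX fdisjointX1 fdisjoint1X
         xG xD GO GD OD.
    split=> // y; rewrite !inE => /orP [/eqP ->|/rx //].
    by rewrite occ_open_var.
  + apply: (can_lam_u (x := x)) => //; first by rewrite /fresh /= xG xO xD.
    apply: IH => //; first by rewrite defP catf_setl ifN // catf_setl ifN.
    by rewrite disjoint3E /= !fdisjointUX !fdisjoint1X xD xO GO GD OD.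
- move=> P c A Sc G O D _; rewrite disjoint3E => /and3P [GO _ _] [_ sN _].
  rewrite (domf_sub_nil sN); apply: at_cst => //.
  by rewrite /disjoint_ctxs /= GO.
- move=> P x A Px G O D defP; rewrite disjoint3E => /and3P [GO GD OD] [_ sN rN].
  have GO2 : disjoint_ctxs [:: G; O] by rewrite /disjoint_ctxs /= GO.
  move: Px; rewrite defP fnd_cat; case: ifP => xD.
  (* Every variable of [D] occurs strictly in [Var x], hence equals [x]. *)
  + move=> Dx; have -> : D = [fmap].[x <- A].
      apply/fmapP => y; rewrite fnd_set fnd_fmap0; case: ifP => [/eqP -> //|ne].
      by apply: not_fnd; apply: contraFN ne => /sN /=; rewrite eq_sym.
    apply: at_var_1 => //.
    by rewrite /fresh /= (fdisjointP_sym GD) // (fdisjointP_sym OD).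
  (* A variable is relevant in itself, which rules out [O]. *)
  + rewrite fnd_cat; case: ifP => [/rN /=|_ Gx]; first by rewrite eqxx.
    rewrite (_ : D = [fmap]); first exact: at_var_u.
    apply: domf_sub_nil => y yD.
    by have /= /eqP eq_xy := sN y yD; rewrite -eq_xy xD in yD.
- move=> P k M N Q R A B _ IHM _ IHN G O D defP dis [/= /andP [mQ mR] sQR rQR].
  move: (dis); rewrite disjoint3E => /and3P [GO GD OD].
  case: k sQR rQR IHM => /= sQR rQR IHM.
  (* Variables of [D] strict in [Q] go to the function; the others are strict in [R] by [sQR]. *)
  + set inQ : pred nat := fun x => occ strict_arg x Q.
    pose DM := filterf D inQ; pose DN := filterf D (predC inQ).
    (* Any splitting works for the variables strict in both [Q] and [R]. *)
    have domM x : (x \in domf DM) = (x \in domf D) && inQ x.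
      by rewrite domf_filterf !inE.
    have domN x : (x \in domf DN) = (x \in domf D) && ~~ inQ x.
      by rewrite domf_filterf !inE.
    have subM : domf DM `<=` domf D by apply/fsubsetP => x; rewrite domM => /andP [].
    have subN : domf DN `<=` domf D by apply/fsubsetP => x; rewrite domN => /andP [].
    have disMN : [disjoint domf DM & domf DN].
      by apply/fdisjointP => x; rewrite domM domN => /andP [-> ->].
    have eqD : D = DM + DN.
      apply/fmapP => x; rewrite fnd_cat domN !fnd_filterf /=.
      by case: (boolP (inQ x)) => /=; case: (boolP (x \in domf D)) => //= /not_fnd.
    have [GM GN] : [disjoint domf G & domf DM] /\ [disjoint domf G & domf DN].
      by split; [apply: fdisjointWr subM GD|apply: fdisjointWr subN GD].
    have [OM ON] : [disjoint domf O & domf DM] /\ [disjoint domf O & domf DN].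
      by split; [apply: fdisjointWr subM OD|apply: fdisjointWr subN OD].
    have rQ : {in domf O, forall x, ~~ occ relevant_arg x Q}.
      by move=> x /rQR; rewrite negb_or => /andP [].
    have rR : {in domf O, forall x, ~~ occ relevant_arg x R}.
      by move=> x /rQR; rewrite negb_or => /andP [].
    rewrite eqD; apply: (at_app_1 (A := A)).
    * by rewrite /disjoint_ctxs /= GO GM GN OM ON disMN.
    * apply: IHM; last by split=> // x; rewrite domM => /andP [].
        rewrite defP eqD (disjoint_catfC disMN) catfA.
        by rewrite (disjoint_catfAC _ ON).
      rewrite disjoint3E domf_cat !fdisjointUX GO GM OM.
      by rewrite ![[disjoint domf DN & _]]fdisjoint_sym ON disMN.
    * apply: IHN.
      - by rewrite defP eqD catfA (disjoint_catfAC _ OM).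
      - rewrite disjoint3E domf_cat !fdisjointUX GO GN ON disMN.
        by rewrite [[disjoint domf DM & _]]fdisjoint_sym OM.
      - split=> // x; rewrite domN => /andP [/sQR].
        by rewrite /inQ; case: (occ _ _ Q).
  + apply: (at_app_0 (A := A)).
      apply: IHM => //; split=> // x; first by move/sQR; rewrite orbF.
      by move/rQR; rewrite orbF.
    (* All variables are unrestricted inside an irrelevant argument, so only modedness of [R]
       remains. *)
    apply: IHN; first by rewrite !catf0.
      by rewrite disjoint3E !fdisjointX0.
    by split=> // x; rewrite domf0.
  + apply: (at_app_u (A := A)).
      apply: IHM => //; split=> // x; first by move/sQR; rewrite orbF.
      by move/rQR; rewrite negb_or => /andP [].
    apply: IHN; first by rewrite defP catf0 (disjoint_catfAC _ OD).
      rewrite disjoint3E !fdisjointX0 domf_cat fdisjointUX GO.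
      by rewrite fdisjoint_sym OD.
    by split=> // x /rQR; rewrite negb_or => /andP [].
Qed.

End Occurrences.

Theorem theorem4p9 (atom con : Type) (Sg : con -> option (ty atom))
    (G O D : ctx atom) (M : tm atom con) (A : ty atom) :
  typing Sg G O D M A ->
  exists N : tm atom con,
    conv_can Sg (G + O + D) M N A /\ canonical Sg G O D N A.
Proof.
move=> tM; have [N cMN] := typing_normalizes tM; exists N; split=> //.
have [mM sM rM] := typing_respects tM.
(* The conditions read off the typing of [M] pass along the conversion to [N]. *)
have [mN sN rN] := (conv_refines Sg).1 _ _ _ _ cMN (typing_lc tM) mM.
apply: (conv_canonical Sg).1 cMN _ _ _ _ _ _ => //; first exact: typing_disjoint tM.
by split=> // x; [move/sM/sN|move/rM; apply: contra => /rN].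
Qed.
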